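(* There exist two infinite sequences of positive integers $A$ and $B = \{b_1 < b_2 < b_3 < \cdots\}$ with $b_1 \in \{4, 7, 8\} \cup \{b \in \mathbb{N} : b \geq 11\}$, $3b_1 + 5 \leq b_2 \leq 6b_1 + 10$ and $b_3 = b_2 + b_1 + 1$ such that $P(A) = \mathbb{N} \setminus B$.
   Context: $\mathbb{N}$ denotes the set of all nonnegative integers. For a set $A = \{a_1 < a_2 < \cdots\}$ of positive integers, $P(A) = \{\sum \varepsilon_i a_i : a_i \in A,\ \varepsilon_i \in \{0,1\},\ \sum \varepsilon_i < \infty\}$ is the set of all finite subset sums of $A$; in particular $0 \in P(A)$ (empty sum). *)

(* Defs.v *)
From mathcomp Require Export all_boot finmap.
From mathcomp Require Export mathcomp_extra boolp classical_sets.

Set Implicit Arguments.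
Unset Strict Implicit.
Unset Printing Implicit Defensive.

Local Open Scope classical_set_scope.

(* An infinite set of positive integers is given by its increasing
   enumeration. *)
Definition pos_increasing (a : nat -> nat) : Prop :=
  (forall i, 0 < a i) /\ {homo a : i j / i < j}.

(* The 0/1 choice of coefficients with finite sum is the finite subset F of A
   on which the coefficient is 1. *)
Definition subset_sums (A : set nat) : set nat :=
  [set n | exists2 F : {fset nat}, [set` F] `<=` A & n = \sum_(x <- F) x].

(* Main.v *)
Require Import Defs.
From mathcomp Require Import zify.

Set Implicit Arguments.
Unset Strict Implicit.
Unset Printing Implicit Defensive.

Local Open Scope classical_set_scope.

(** The subset sums of {1, 2, 5, 6, 7} are the numbers up to 21 other than 4
    and 17, and by binary expansion those of the numbers 24 * 2 ^ j are the
    multiples of 24.  Hence, for A the union of these two sets, P(A) consists of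
    the n whose residue modulo 24 is none of 4, 17, 22, 23.  Its complement is
    B = {4, 17, 22, 23, 28, ...}, in which 22 = 17 + 4 + 1. *)

Section SubsetSums.

Implicit Types (A B : set nat) (s : seq nat).

Lemma subset_sums_sum A s :
  uniq s -> [set` s] `<=` A -> subset_sums A (\sum_(x <- s) x).
Proof.
move=> s_uniq sA; exists [fset x in s]%fset => [x /=|].
  by rewrite inE => /sA.
apply: perm_big; apply: uniq_perm => // [|x]; first exact: fset_uniq.
by rewrite inE.
Qed.

Lemma subset_sums0 A : subset_sums A 0.
Proof. by rewrite -(@big_nil _ 0 addn _ xpredT id); apply: subset_sums_sum. Qed.

Lemma sub_subset_sums A : A `<=` subset_sums A.
Proof.
move=> x Ax; rewrite -(@big_seq1 _ 0 addn _ x id).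
by apply: subset_sums_sum => // y; rewrite /= inE => /eqP ->.
Qed.

Lemma subset_sums_set0 : subset_sums set0 = [set 0].
Proof.
apply/seteqP; split=> [n [F F0 ->]|_ ->]; last exact: subset_sums0.
by rewrite big_seq big1 // => x /F0.
Qed.

Lemma subset_sumsU A B : A `&` B = set0 ->
  subset_sums (A `|` B) = [set x + y | x in subset_sums A & y in subset_sums B].
Proof.
move=> AB0; apply/seteqP; split=> n.
- case=> F FAB ->.
  rewrite (bigID [pred x | x \in A]) /= -big_filter -[X in _ + X]big_filter.
  exists (\sum_(x <- [seq x <- F | x \in A]) x).
    apply: subset_sums_sum => [|x /=]; first exact/filter_uniq/fset_uniq.
    by rewrite mem_filter => /andP[/set_mem].
  exists (\sum_(x <- [seq x <- F | x \notin A]) x) => //.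
  apply: subset_sums_sum => [|x /=]; first exact/filter_uniq/fset_uniq.
  rewrite mem_filter => /andP[/negP xA /FAB[Ax|//]].
  by case: xA; apply: mem_set.
- case=> _ [F FA ->] [_ [G GB ->] <-].
  rewrite -big_cat; apply: subset_sums_sum => [|x /=]; last first.
    by rewrite mem_cat => /orP[/FA|/GB]; [left | right].
  rewrite cat_uniq !fset_uniq andbT; apply/hasPn => x xG; apply/negP => xF.
  by have : (A `&` B) x; [split; [apply: FA | apply: GB] | rewrite AB0].
Qed.

Lemma subset_sums_set1 x : subset_sums [set x] = [set 0; x].
Proof.
apply/seteqP; split=> [n|n [->|->]]; last 2 first.
- exact: subset_sums0.
- exact: sub_subset_sums.
case=> F Fx ->; have [xF|xF] := boolP (x \in F); [right | left].
- rewrite (bigD1_seq x) ?fset_uniq //= big1_seq ?addn0 //.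
  by move=> y /andP[y_neq /Fx y_eq]; rewrite y_eq eqxx in y_neq.
- rewrite big1_seq // => y /andP[_ yF].
  by rewrite -(Fx y yF) yF in xF.
Qed.

Lemma subset_sumsU1 x A : ~ A x ->
  subset_sums (x |` A) = subset_sums A `|` addn x @` subset_sums A.
Proof.
move=> nAx; rewrite subset_sumsU ?subset_sums_set1; last first.
  by apply/seteqP; split=> // y [-> /nAx].
apply/seteqP; split=> n.
- by case=> _ [->|->] [y Ay <-]; [left | right; exists y].
- case=> [An|[y Ay <-]]; first by exists 0; [left | exists n].
  by exists x; [right | exists y].
Qed.

Lemma subset_sums_muln d A : 0 < d ->
  subset_sums (muln d @` A) = muln d @` subset_sums A.
Proof.
move=> d_gt0; have muln_inj : injective (muln d).
  by move=> x y /eqP; rewrite eqn_pmul2l // => /eqP.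
apply/seteqP; split=> [_ [F FdA ->]|_ [_ [F FA ->] <-]].
- have F_mul : F = map (muln d) [seq x %/ d | x <- F] :> seq nat.
    rewrite -map_comp -[LHS]map_id; apply/eq_in_map => _ /FdA[x _ <-] /=.
    by rewrite mulKn.
  exists (\sum_(x <- [seq x %/ d | x <- F]) x); last first.
    by rewrite [in RHS]F_mul [RHS]big_map big_distrr.
  apply: subset_sums_sum => [|_ /mapP[_ /FdA[x Ax <-] ->]].
    by rewrite -(map_inj_uniq muln_inj) -F_mul fset_uniq.
  by rewrite mulKn.
- rewrite big_distrr -(big_map (muln d) xpredT id) /=.
  apply: subset_sums_sum => [|_ /mapP[x /FA Ax ->]]; last by exists x.
  by rewrite map_inj_uniq ?fset_uniq.
Qed.

Lemma range_expn d : range (expn d) = 1 |` muln d @` range (expn d).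
Proof.
apply/seteqP; split=> [_ [[|j] _ <-]|_ [->|[_ [j _ <-] <-]]].
- by left.
- by right; exists (d ^ j); rewrite ?expnS.
- by exists 0.
- by exists j.+1; rewrite ?expnS.
Qed.

Lemma subset_sums_expn2 : subset_sums (range (expn 2)) = setT.
Proof.
apply/seteqP; split=> // n _; elim/ltn_ind: n => -[|n] IHn.
  exact: subset_sums0.
have half_sum : subset_sums (range (expn 2)) n.+1./2 by apply: IHn; lia.
rewrite range_expn subset_sumsU1 ?subset_sums_muln //; last by case=> j _; lia.
have [n_odd|n_even] := boolP (odd n.+1).
- by right; exists (2 * n.+1./2); [exists n.+1./2 | lia].
- by left; exists n.+1./2 => //; lia.
Qed.

Definition seq_sums s : seq nat :=
  foldr (fun x sums => sums ++ map (addn x) sums) [:: 0] s.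

Lemma subset_sums_seq s : uniq s -> subset_sums [set` s] = [set` seq_sums s].
Proof.
elim: s => [_|x s IHs /= /andP[/negP xs s_uniq]].
  by rewrite set_nil subset_sums_set0 /= set_cons1.
have -> : [set` x :: s] = x |` [set` s].
  by apply/predeqP => y /=; rewrite inE; split=> /predU1P.
rewrite subset_sumsU1 // IHs //; apply/seteqP; split=> n /=; rewrite mem_cat.
- by case=> [->//|[y ys <-]]; rewrite (map_f (addn x)) ?orbT.
- by case/orP=> [|/mapP[y ys ->]]; [left | right; exists y].
Qed.

Lemma subset_sums_modn d A : subset_sums A `<=` [set n | n < d] ->
  subset_sums (A `|` range (fun j => d * 2 ^ j)) =
    [set n | subset_sums A (n %% d)].
Proof.
move=> sums_lt; have d_gt0 : 0 < d by apply: sums_lt; apply: subset_sums0.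
have -> : range (fun j => d * 2 ^ j) = muln d @` range (expn 2).
  by rewrite image_comp.
rewrite subset_sumsU ?subset_sums_muln ?subset_sums_expn2 //; last first.
  apply/seteqP; split=> // x [/sub_subset_sums/sums_lt /=].
  by move=> + [_ [j _ <-] x_mul]; rewrite -x_mul ltnNge leq_pmulr ?expn_gt0.
apply/seteqP; split=> [_ [x Ax [_ [q _ <-] <-]] /=|n An].
  by rewrite addnC mulnC modnMDl modn_small //; apply: sums_lt.
exists (n %% d) => //; exists (d * (n %/ d)); first by exists (n %/ d).
by rewrite addnC mulnC -divn_eq.
Qed.

End SubsetSums.

Section Enumerations.

Implicit Types (u : nat -> nat) (s r : seq nat).

Lemma pos_increasingP u :
  pos_increasing u <-> 0 < u 0 /\ forall i, u i < u i.+1.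
Proof.
split=> [[u_gt0 u_homo]|[u0_gt0 u_ltS]]; first by split=> // i; apply: u_homo.
have u_homo : {homo u : i j / i < j} by apply: homo_ltn u_ltS; apply: ltn_trans.
by split=> // -[|i] //; apply: ltn_trans u0_gt0 (u_homo 0 i.+1 isT).
Qed.

Lemma pos_increasing_muln_expn d b :
  0 < d -> 1 < b -> pos_increasing (fun j => d * b ^ j).
Proof.
move=> d_gt0 b_gt1; apply/pos_increasingP; split=> [|j]; first by rewrite muln1.
by rewrite ltn_pmul2l ?ltn_exp2l.
Qed.

(* Past the end of [s], [nth] returns its default value, here a term of [u]. *)
Definition prepend s u (i : nat) : nat := nth (u (i - size s)) s i.

Lemma range_prepend s u : range (prepend s u) = [set` s] `|` range u.
Proof.
apply/seteqP; split=> [_ [i _ <-]|x [/(nthP 0)[i i_lt <-]|[i _ <-]]].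
- have [i_lt|i_ge] := ltnP i (size s); first by left; apply: mem_nth.
  by right; rewrite /prepend nth_default //; exists (i - size s).
- by exists i => //; apply: set_nth_default.
- by exists (i + size s); rewrite // /prepend nth_default ?leq_addl // addnK.
Qed.

Lemma pos_increasing_prepend s u : path ltn 0 s -> last 0 s < u 0 ->
  pos_increasing u -> pos_increasing (prepend s u).
Proof.
move=> s_path s_last /pos_increasingP[_ u_ltS]; apply/pos_increasingP.
have prepend_ltS x t : path ltn x t -> last x t < u 0 ->
    x < prepend t u 0 /\ forall i, prepend t u i < prepend t u i.+1.
  elim: t x => [|y t IHt] x /=.
    by rewrite /prepend => _ x_lt; split=> [|i]; rewrite !nth_nil ?subn0.
  case/andP=> xy t_path t_last; have [y_lt t_ltS] := IHt y t_path t_last.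
  by split=> // -[|i]; [apply: y_lt | apply: t_ltS].
exact: prepend_ltS.
Qed.

Definition residue_seq d r (i : nat) : nat :=
  d * (i %/ size r) + nth 0 r (i %% size r).

Lemma residue_seqMDl d r q k : k < size r ->
  residue_seq d r (q * size r + k) = d * q + nth 0 r k.
Proof.
move=> k_lt; have r_gt0 : 0 < size r by apply: leq_ltn_trans k_lt.
rewrite /residue_seq divnMDl // modnMDl (divn_small k_lt) (modn_small k_lt).
by rewrite addn0.
Qed.

Lemma range_residue_seq d r : 0 < size r -> all (gtn d) r ->
  range (residue_seq d r) = [set n | n %% d \in r].
Proof.
move=> r_gt0 /allP r_lt; apply/seteqP; split=> n /=.
  case=> i _ <-.
  have nth_in : nth 0 r (i %% size r) \in r by rewrite mem_nth ?ltn_mod.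
  by rewrite /residue_seq mulnC modnMDl modn_small //; apply: r_lt.
case/(nthP 0)=> k k_lt n_mod; exists (n %/ d * size r + k) => //.
by rewrite residue_seqMDl // n_mod mulnC -divn_eq.
Qed.

Lemma pos_increasing_residue_seq d r : 0 < size r -> all (gtn d) r ->
  path ltn 0 r -> pos_increasing (residue_seq d r).
Proof.
move=> r_gt0 /allP r_lt /(pathP 0) r_path; apply/pos_increasingP.
have r0_gt0 : 0 < nth 0 r 0 by apply: (r_path 0).
split=> [|i]; first by rewrite /residue_seq div0n mod0n muln0.
rewrite (divn_eq i (size r)); have := ltn_pmod i r_gt0.
move: (i %/ size r) (i %% size r) => q k k_lt.
have nth_lt : nth 0 r k < d by apply/r_lt/mem_nth.
rewrite -addnS residue_seqMDl //; have [k_last|k_next] := eqVneq k.+1 (size r).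
  rewrite k_last -mulSnr -[q.+1 * _]addn0 residue_seqMDl // mulnS; lia.
have kS_lt : k.+1 < size r by lia.
by rewrite residue_seqMDl // ltn_add2l; apply: (r_path k.+1).
Qed.

End Enumerations.

(* b is indexed from 0: b 0, b 1, b 2 are b_1, b_2, b_3. *)
Theorem theorem1p2 :
  exists a b : nat -> nat,
    [/\ pos_increasing a /\ pos_increasing b,
        ([set 4; 7; 8] `|` [set m | 11 <= m]) (b 0),
        3 * b 0 + 5 <= b 1 <= 6 * b 0 + 10,
        b 2 = b 1 + b 0 + 1
      & subset_sums (range a) = setT `\` range b].
Proof.
pose small := [:: 1; 2; 5; 6; 7]; pose missing := [:: 4; 17; 22; 23].
exists (prepend small (fun j => 24 * 2 ^ j)), (residue_seq 24 missing).
split=> //; first split.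
- by apply: pos_increasing_prepend => //; apply: pos_increasing_muln_expn.
- exact: pos_increasing_residue_seq.
- by left; left; left.
have small_sums : subset_sums [set` small] = [set` seq_sums small].
  exact: subset_sums_seq.
have small_sums_compl r : r < 24 -> (r \in seq_sums small) = (r \notin missing).
  by do 24 (case: r => [|r] //).
rewrite range_prepend subset_sums_modn small_sums; last first.
  by move=> r; apply/allP: r.
rewrite range_residue_seq // setTD; apply/seteqP.
by split=> n /=; rewrite small_sums_compl ?ltn_mod // => /negP.
Qed.
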